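(* Let $\tau>0$, let $M$ be a symmetric positive definite real $N\times N$ matrix, let $A$ be a symmetric positive semidefinite real $N\times N$ matrix, and let $F\in\mathbb{R}^N$. Let $\theta\in\mathbb{R}$ with $\theta\ge 1/2$, and let $(u^n)_{n\ge 0}$ be a sequence in $\mathbb{R}^N$ satisfying the two-level weighted scheme $$M\,\frac{u^{n+1}-u^n}{\tau}+A\big(\theta u^{n+1}+(1-\theta)u^n\big)=F,\qquad n=0,1,2,\dots$$ Then the scheme is stable in the sense that, for every $n\ge 0$, $$\|u^{n+1}\|_A^2\le \|u^n\|_A^2+\frac{\tau}{2}\,\|F\|_{M^{-1}}^2 .$$
   Context: $(\cdot,\cdot)$ is the Euclidean inner product on $\mathbb{R}^N$. For a symmetric positive semidefinite matrix $B$, $\|v\|_B^2:=(Bv,v)$ (a seminorm in general). $\tau$ is the uniform time step and $u^n$ is the approximation at time $t_n=n\tau$ for the semi-discrete system $M\,\partial_t u+Au=F$ obtained from the space discretization of a multicontinuum flow problem. *)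

(* Defs.v *)
From mathcomp Require Import all_boot all_order all_algebra.
From mathcomp Require Export reals.

Set Implicit Arguments.
Unset Strict Implicit.
Unset Printing Implicit Defensive.

Import Order.TTheory GRing.Theory Num.Theory.
Local Open Scope ring_scope.

Definition dotp (R : realType) (N : nat) (u v : 'cV[R]_N) : R :=
  \sum_(i < N) u i 0 * v i 0.

(* The squared (semi)norm ||v||_B^2 = (B v, v); it is one only when B is
   symmetric positive semidefinite, which the definition does not require. *)
Definition sqnorm (R : realType) (N : nat) (B : 'M[R]_N) (v : 'cV[R]_N) : R :=
  dotp (B *m v) v.

Definition sym_psd (R : realType) (N : nat) (B : 'M[R]_N) : Prop :=
  B \is symmetricmx /\ forall v : 'cV[R]_N, 0 <= dotp (B *m v) v.

Definition sym_pd (R : realType) (N : nat) (B : 'M[R]_N) : Prop :=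
  B \is symmetricmx /\ forall v : 'cV[R]_N, v != 0 -> 0 < dotp (B *m v) v.

Definition weighted_scheme (R : realType) (N : nat) (tau theta : R)
    (M A : 'M[R]_N) (F : 'cV[R]_N) (u : nat -> 'cV[R]_N) : Prop :=
  forall n : nat,
    M *m (tau^-1 *: (u n.+1 - u n))
      + A *m (theta *: u n.+1 + (1 - theta) *: u n) = F.

Lemma symmetricmxE (R : realType) (N : nat) (B : 'M[R]_N) :
  (B \is symmetricmx) = (B^T == B).
Proof. by rewrite is_hermitianmxE expr0 scale1r map_mx_id // eq_sym. Qed.

(* For a positive definite M, invmx M is the true inverse (invmx returns its
   argument on a singular matrix). *)
Lemma sym_pd_unitmx (R : realType) (N : nat) (M : 'M[R]_N) :
  sym_pd M -> M \in unitmx.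
Proof.
case=> /[!symmetricmxE] /eqP Msym Mpd; rewrite -row_free_unit -kermx_eq0.
apply/eqP/row_matrixP => i; rewrite row0; apply/eqP/negPn/negP => k_neq0.
have kM0 : M *m (row i (kermx M))^T = 0.
  by rewrite -[M in M *m _]Msym -trmx_mul -row_mul mulmx_ker row0 trmx0.
have := Mpd (row i (kermx M))^T; rewrite kM0 trmx_eq0 => /(_ k_neq0).
by rewrite /dotp big1 ?ltxx // => j _; rewrite mxE mul0r.
Qed.

(* Main.v *)
(* With w = (u^{n+1} - u^n) / tau, expanding the quadratic form and using the
   scheme gives
     |u^{n+1}|_A^2 - |u^n|_A^2
       = 2 tau ((F, w) - (M w, w)) - tau^2 (2 theta - 1) (A w, w).
   The last term is nonpositive, and (F, w) - (M w, w) is at most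
   (M^-1 F, F) / 4 by completing the square in the M-norm. *)
Require Import Defs.
From mathcomp Require Import all_boot all_order all_algebra.
From mathcomp Require Import reals.
From mathcomp Require Import ring lra.

Import Order.TTheory GRing.Theory Num.Theory.
Local Open Scope ring_scope.

Lemma dotpC (R : realType) (N : nat) (u v : 'cV[R]_N) : dotp u v = dotp v u.
Proof. by apply: eq_bigr => i _; rewrite mulrC. Qed.

Lemma dotpDl (R : realType) (N : nat) (u v w : 'cV[R]_N) :
  dotp (u + v) w = dotp u w + dotp v w.
Proof. by rewrite -big_split; apply: eq_bigr => i _; rewrite mxE mulrDl. Qed.

Lemma dotpZl (R : realType) (N : nat) (a : R) (u v : 'cV[R]_N) :
  dotp (a *: u) v = a * dotp u v.
Proof. by rewrite mulr_sumr; apply: eq_bigr => i _; rewrite mxE mulrA. Qed.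

Lemma dotpDr (R : realType) (N : nat) (u v w : 'cV[R]_N) :
  dotp u (v + w) = dotp u v + dotp u w.
Proof. by rewrite !(dotpC _ _ u) dotpDl. Qed.

Lemma dotpZr (R : realType) (N : nat) (a : R) (u v : 'cV[R]_N) :
  dotp u (a *: v) = a * dotp u v.
Proof. by rewrite !(dotpC _ _ u) dotpZl. Qed.

Lemma dotpE (R : realType) (N : nat) (u v : 'cV[R]_N) :
  dotp u v = (u^T *m v) 0 0.
Proof. by rewrite mxE; apply: eq_bigr => i _; rewrite mxE. Qed.

Lemma dotp_symmetric (R : realType) (N : nat) (B : 'M[R]_N) (u v : 'cV[R]_N) :
  B \is symmetricmx -> dotp (B *m u) v = dotp (B *m v) u.
Proof.
rewrite symmetricmxE => /eqP Bsym.
by rewrite [RHS]dotpC !dotpE trmx_mul Bsym mulmxA.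
Qed.

Lemma sqnormDZ (R : realType) (N : nat) (B : 'M[R]_N) (a : R)
    (v w : 'cV[R]_N) : B \is symmetricmx ->
  sqnorm B (v + a *: w)
    = sqnorm B v + 2 * a * dotp (B *m v) w + a ^+ 2 * sqnorm B w.
Proof.
move=> Bsym; rewrite /sqnorm mulmxDr -scalemxAr !(dotpDl, dotpDr).
rewrite !(dotpZl, dotpZr) (dotp_symmetric _ _ _ w v Bsym); ring.
Qed.

Lemma sym_pd_sqnorm_ge0 (R : realType) (N : nat) (M : 'M[R]_N)
    (v : 'cV[R]_N) : sym_pd M -> 0 <= sqnorm M v.
Proof.
case=> _ Mpd; have [->|/Mpd/ltW//] := eqVneq v 0.
by rewrite /sqnorm /dotp big1 // => i _; rewrite !mxE mulr0.
Qed.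

Lemma dotp_sub_sqnorm_le (R : realType) (N : nat) (M : 'M[R]_N)
    (F w : 'cV[R]_N) : sym_pd M ->
  dotp F w - sqnorm M w <= sqnorm (invmx M) F / 4.
Proof.
move=> M_spd; have [Msym _] := M_spd; set g := invmx M *m F.
have Mg : M *m g = F by rewrite mulKVmx // sym_pd_unitmx.
have := sym_pd_sqnorm_ge0 _ _ _ (w + (- 2^-1) *: g) M_spd.
rewrite sqnormDZ // (dotp_symmetric _ _ _ w g Msym) Mg.
have -> : sqnorm M g = sqnorm (invmx M) F by rewrite /sqnorm Mg dotpC.
by lra.
Qed.

Theorem theorem1 (R : realType) (N : nat) (tau : R) (M A : 'M[R]_N)
    (F : 'cV[R]_N) (theta : R) (u : nat -> 'cV[R]_N)
    (tau_gt0 : 0 < tau)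
    (M_spd : sym_pd M)
    (A_spsd : sym_psd A)
    (theta_ge : 1 / 2 <= theta)
    (u_scheme : weighted_scheme tau theta M A F u) :
  forall n : nat,
    sqnorm A (u n.+1) <= sqnorm A (u n) + tau / 2 * sqnorm (invmx M) F.
Proof.
move=> n; have [Asym Apsd] := A_spsd.
have := u_scheme n; set w := tau^-1 *: (u n.+1 - u n).
have uS : u n.+1 = u n + tau *: w.
  by rewrite scalerA mulfV ?gt_eqF // scale1r addrC subrK.
have -> : theta *: u n.+1 + (1 - theta) *: u n = u n + (theta * tau) *: w.
  by rewrite uS scalerDr scalerA addrAC -scalerDl subrKC scale1r.
move=> /(congr1 (fun x => dotp x w)).
rewrite mulmxDr -(scalemxAr _ A) !dotpDl dotpZl -!/(sqnorm _ w) => eqF.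
rewrite uS sqnormDZ //.
have := dotp_sub_sqnorm_le _ _ _ F w M_spd; rewrite -eqF => le_w.
have : 0 <= tau ^+ 2 * ((2 * theta - 1) * sqnorm A w).
  apply: mulr_ge0; first exact: sqr_ge0.
  by apply: mulr_ge0; [lra | exact: Apsd].
by have := ler_wpM2l (ltW tau_gt0) le_w; lra.
Qed.
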